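(* Let $\gamma(t)=(x(t),y(t),z(t))$ be a generic unit-speed geodesic in $\mathrm{SOL}$ with nonzero constants of motion $a,b$. Denote by $h$ its average height and by $k$ its modulus, and define $$M(k)=4\int_0^{A(k)}\frac{\cosh(2\zeta)\,d\zeta}{\sqrt{1-2|ab|\cosh(2\zeta)}},$$ where $A(k)=\operatorname{arctanh}(k)$ is the amplitude. Let $T(k)$ be the period. Then: (A) For every $t_0\in\mathbb{R}$ we have $z(t_0+T(k))=z(t_0)$ and $$\gamma(t_0+T(k))-\gamma(t_0)=\operatorname{sgn}(ab)\,M(k)\,(b,a,0)$$ (difference of coordinate vectors in $\mathbb{R}^3$). (B) The horizontal distance between these points is equal to $$\delta\bigl(\gamma(t_0),\gamma(t_0+T(k))\bigr)=M(k)\sqrt{2|ab|\cosh\bigl(2(z(t_0)-h)\bigr)}.$$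
   Context: $\mathrm{SOL}$ is $\mathbb{R}^3$ with coordinates $(x,y,z)$ and the Riemannian metric $ds^2=e^{-2z}dx^2+e^{2z}dy^2+dz^2$; it is complete and geodesics are defined on all of $\mathbb{R}$. For a unit-speed geodesic $\gamma=(x,y,z)$ the quantities $a=e^{-2z}\dot x$ and $b=e^{2z}\dot y$ are constant (the *principal constants of motion* ). The *modulus* is $k=\sqrt{\frac{1-2|ab|}{1+2|ab|}}$, so that $2|ab|=\frac{1-k^2}{1+k^2}$. A geodesic is *generic* if none of the coordinate functions $x(t),y(t),z(t)$ is constant; then $ab\ne0$ and $0<k<1$. The *average height* is $h=\frac12\log|b/a|$. The function $z(t)$ of a generic unit-speed geodesic oscillates between $h-A(k)$ and $h+A(k)$ and is periodic, with period $$T(k)=4\int_0^{A(k)}\frac{d\zeta}{\sqrt{1-2|ab|\cosh(2\zeta)}}.$$ For two points $p_1=(x_1,y_1,z)$, $p_2=(x_2,y_2,z)$ at the same height $z$, the *horizontal distance* is $\delta(p_1,p_2)=\sqrt{e^{-2z}(x_2-x_1)^2+e^{2z}(y_2-y_1)^2}$. *)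

(* Defs.v *)
From Stdlib Require Import Reals Lra.
From Coquelicot Require Import Coquelicot.
Open Scope R_scope.

Inductive axis := Ox | Oy | Oz.

Definition sum_axis (f : axis -> R) : R := f Ox + f Oy + f Oz.

Definition point : Type := (R * R * R)%type.

Definition coord (i : axis) (p : point) : R :=
  match i with
  | Ox => fst (fst p)
  | Oy => snd (fst p)
  | Oz => snd p
  end.

Definition basis (i : axis) : point :=
  match i with
  | Ox => (1, 0, 0)
  | Oy => (0, 1, 0)
  | Oz => (0, 0, 1)
  end.

Definition partial (i : axis) (f : point -> R) (p : point) : R :=
  Derive (fun s => f (plus p (scal s (basis i)))) 0.

(** The metric tensor of SOL, [ds^2 = e^(-2z) dx^2 + e^(2z) dy^2 + dz^2]. *)
Definition metric (p : point) (i j : axis) : R :=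
  match i, j with
  | Ox, Ox => exp (- 2 * coord Oz p)
  | Oy, Oy => exp (2 * coord Oz p)
  | Oz, Oz => 1
  | _, _ => 0
  end.

Definition inverse_metric (p : point) (i j : axis) : R :=
  match i, j with
  | Ox, Ox => exp (2 * coord Oz p)
  | Oy, Oy => exp (- 2 * coord Oz p)
  | Oz, Oz => 1
  | _, _ => 0
  end.

Lemma metric_inverse_metric (p : point) (i j : axis) :
  sum_axis (fun l => metric p i l * inverse_metric p l j) =
  match i, j with
  | Ox, Ox | Oy, Oy | Oz, Oz => 1
  | _, _ => 0
  end.
Proof.
  assert (H : exp (- 2 * coord Oz p) * exp (2 * coord Oz p) = 1).
  { rewrite <- exp_plus, <- exp_0; f_equal; ring. }
  destruct i, j; unfold sum_axis, metric, inverse_metric; lra.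
Qed.

(** [christoffel m i j] is the symbol of the second kind with upper index [m]. *)
Definition christoffel (m i j : axis) (p : point) : R :=
  / 2 * sum_axis (fun l =>
    inverse_metric p m l *
    (partial i (fun q => metric q j l) p
     + partial j (fun q => metric q i l) p
     - partial l (fun q => metric q i j) p)).

Definition velocity (gamma : R -> point) (i : axis) (t : R) : R :=
  Derive (fun s => coord i (gamma s)) t.

Definition is_geodesic (gamma : R -> point) : Prop :=
  forall (i : axis) (t : R),
    ex_derive (fun s => coord i (gamma s)) t /\
    ex_derive (velocity gamma i) t /\
    Derive (velocity gamma i) t
    + sum_axis (fun j => sum_axis (fun l =>
        christoffel i j l (gamma t) * velocity gamma j t * velocity gamma l t))
    = 0.

Definition unit_speed (gamma : R -> point) : Prop :=
  forall t : R,
    sqrt (sum_axis (fun i => sum_axis (fun j =>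
      metric (gamma t) i j * velocity gamma i t * velocity gamma j t))) = 1.

Definition is_generic (gamma : R -> point) : Prop :=
  forall i : axis, ~ (exists c : R, forall t : R, coord i (gamma t) = c).

(** The principal constants of motion.  The two quantities do not depend on time
    along a geodesic; they are read off at time 0, so that constancy is not
    an assumption. *)
Definition motion_a (gamma : R -> point) : R :=
  exp (- 2 * coord Oz (gamma 0)) * velocity gamma Ox 0.

Definition motion_b (gamma : R -> point) : R :=
  exp (2 * coord Oz (gamma 0)) * velocity gamma Oy 0.

Definition modulus (a b : R) : R :=
  sqrt ((1 - 2 * Rabs (a * b)) / (1 + 2 * Rabs (a * b))).

Definition average_height (a b : R) : R := / 2 * ln (Rabs (b / a)).

Definition artanh (u : R) : R := / 2 * ln ((1 + u) / (1 - u)).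

Lemma tanh_artanh (u : R) : -1 < u < 1 -> tanh (artanh u) = u.
Proof.
  intros Hu; unfold tanh, sinh, cosh.
  assert (Hpos : 0 < (1 + u) / (1 - u)) by (apply Rdiv_lt_0_compat; lra).
  assert (Hsq : exp (artanh u) * exp (artanh u) = (1 + u) / (1 - u)).
  { rewrite <- exp_plus; unfold artanh.
    replace (/ 2 * ln ((1 + u) / (1 - u)) + / 2 * ln ((1 + u) / (1 - u)))
      with (ln ((1 + u) / (1 - u))) by field.
    now apply exp_ln. }
  rewrite exp_Ropp.
  pose proof (exp_pos (artanh u)) as He.
  set (e := exp (artanh u)) in *.
  assert (Hsq' : e * e * (1 - u) = 1 + u) by (rewrite Hsq; field; lra).
  assert (H1 : e * e + 1 <> 0) by nra.
  replace ((e - / e) / 2 / ((e + / e) / 2)) with ((e * e - 1) / (e * e + 1))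
    by (field; split; lra).
  apply Rmult_eq_reg_r with (e * e + 1); [| exact H1].
  unfold Rdiv; rewrite Rmult_assoc, Rinv_l by exact H1; lra.
Qed.

Definition amplitude (a b : R) : R := artanh (modulus a b).

(** The integrands of [period] and [displacement] are singular at the upper end
    [amplitude a b], hence the improper integrals. *)
Definition period (a b : R) : R :=
  4 * RInt_gen (fun zeta => 1 / sqrt (1 - 2 * Rabs (a * b) * cosh (2 * zeta)))
        (at_point 0) (at_left (amplitude a b)).

Definition displacement (a b : R) : R :=
  4 * RInt_gen
        (fun zeta =>
          cosh (2 * zeta) / sqrt (1 - 2 * Rabs (a * b) * cosh (2 * zeta)))
        (at_point 0) (at_left (amplitude a b)).

(** Meant for points of equal height; the height is taken from [p1]. *)
Definition horizontal_distance (p1 p2 : point) : R :=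
  sqrt (exp (- 2 * coord Oz p1) * (coord Ox p2 - coord Ox p1) ^ 2
        + exp (2 * coord Oz p1) * (coord Oy p2 - coord Oy p1) ^ 2).

(* Main.v *)
Require Import Defs.
From Stdlib Require Import Reals Lra FunctionalExtensionality.
From Coquelicot Require Import Coquelicot.
Open Scope R_scope.

(** Write [c = 2 |a b|], [zeta = z - h] and [eta = z'].  The first integrals
    [x' = a e^(2z)] and [y' = b e^(-2z)], together with the third geodesic
    equation and unit speed, reduce the motion to the oscillator
    [zeta'' = - c sinh (2 zeta)] at the energy level
    [zeta'^2 = 1 - c cosh (2 zeta)] ([geodesic_oscillation]); in these terms
    [x' = sgn(ab) b (cosh (2 zeta) + sinh (2 zeta))] and
    [y' = sgn(ab) a (cosh (2 zeta) - sinh (2 zeta))]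
    ([horizontal_velocity]).  Since [sinh (2 zeta) = - eta' / c], the hyperbolic
    sine contributes nothing over a period, and both displacements come from the
    time integral of [cosh (2 zeta)] ([coordinate_increment]).  For the distance,
    the metric turns the displacement [sgn(ab) M (b, a)] into
    [M sqrt (a^2 e^(2z) + b^2 e^(-2z))], and the sum under the root is
    [c cosh (2 zeta)] ([cosh_height]).

    The periods are computed without splitting the orbit at its turning points,
    where the substitution [dt = d zeta / zeta'] degenerates.  As
    [c cosh (2 A) = 1], the energy level is
    [zeta'^2 + 2 c sinh^2 zeta = 2 c sinh^2 A], a circle in the plane of
    [sqrt (2c) sinh zeta] and [zeta'].  An angle [theta] on it
    ([exists_phase]) satisfies
    [theta' = sqrt (2c) cosh zeta = sqrt (2c) sqrt (1 + sinh^2 A sin^2 theta)],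
    which is positive and regular everywhere.  Hence for every continuous
    weight [w] the time integral of [w (sinh^2 zeta)] is the integral over
    [theta] of the continuous function [phase_density c A w].  That function is
    even and [PI]-periodic, so a full turn contributes four times its integral over
    [[0, PI/2]] ([RInt_add_2PI]), and the substitution
    [sinh zeta = sinh A sin theta] identifies this quarter with the improper
    integral over heights ([RInt_gen_height]).  The weight [w = 1] shows that a
    full turn takes exactly the time [T] ([phase_advance]); the weight
    [w (u) = 1 + 2u], for which [w (sinh^2 zeta) = cosh (2 zeta)], gives [M]. *)

(** * Integrals and antiderivatives *)

Lemma constant_of_zero_derivative (f : R -> R) :
  (forall t, is_derive f t 0) -> forall s t, f s = f t.
Proof.
  intros Hf s t.
  destruct (Rtotal_order s t) as [H | [-> | H]]; trivial.
  - apply eq_is_derive; auto.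
  - symmetry; apply eq_is_derive; auto.
Qed.

Lemma is_derive_RInt_continuous (f : R -> R) (x : R) :
  (forall t, continuous f t) -> is_derive (RInt f 0) x (f x).
Proof.
  intros Hf; apply is_derive_RInt with 0; [| apply Hf].
  apply filter_forall; intros y; apply RInt_correct.
  apply ex_RInt_continuous; auto.
Qed.

(** The fundamental theorem of calculus for an integrand that may be singular at
    the upper end, as those of [period] and [displacement] are: the
    antiderivative only has to extend continuously there. *)
Lemma is_RInt_gen_antiderivative (F f : R -> R) (a b l : R) :
  a < b ->
  (forall x, a <= x < b -> is_derive F x (f x)) ->
  (forall x, a <= x < b -> continuous f x) ->
  filterlim F (at_left b) (locally l) ->
  is_RInt_gen f (at_point a) (at_left b) (l - F a).
Proof.
  intros Hab HF Hf Hlim P HP.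
  assert (HFa : filterlim (fun x => F x - F a) (at_left b) (locally (l - F a))).
  { apply (filterlim_comp _ _ _ F (fun y => y - F a) _ _ _ Hlim).
    apply (continuous_minus (V := R_NormedModule) (fun y => y) (fun _ => F a)).
    - apply continuous_id.
    - apply continuous_const. }
  specialize (HFa P HP); unfold filtermap in HFa.
  apply Filter_prod with (Q := fun x => x = a)
    (R := fun x => a < x < b /\ P (F x - F a)).
  - reflexivity.
  - apply filter_and; [| exact HFa].
    assert (Hd : 0 < b - a) by lra.
    exists (mkposreal _ Hd); intros x Hx Hxb.
    unfold ball in Hx; simpl in Hx; unfold AbsRing_ball, abs, minus, plus, opp in Hx;
      simpl in Hx.
    apply Rabs_def2 in Hx; lra.
  - intros x y -> [Hy HPy]; simpl.
    exists (F y - F a); split; [| exact HPy].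
    apply (is_RInt_derive F f); rewrite Rmin_left, Rmax_right by lra;
      intros x Hx; [apply HF | apply Hf]; lra.
Qed.

(** By [PI]-periodicity the integral over [[0, PI]] is added at each half turn;
    evenness and periodicity make [f] symmetric about [PI / 2], which halves it
    again. *)
Lemma RInt_add_2PI (f : R -> R) (x : R) :
  (forall t, continuous f t) ->
  (forall t, f (t + PI) = f t) ->
  (forall t, f (- t) = f t) ->
  RInt f 0 (x + 2 * PI) = RInt f 0 x + 4 * RInt f 0 (PI / 2).
Proof.
  intros Hf Hper Heven.
  assert (HF := fun x => is_derive_RInt_continuous f x Hf).
  set (F := RInt f 0) in *.
  assert (HF0 : F 0 = 0) by apply (RInt_point (V := R_CompleteNormedModule)).
  assert (Hshift : forall y, F (y + PI) = F y + F PI).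
  { intros y.
    assert (H := constant_of_zero_derivative (fun t => F (t + PI) - F t)).
    specialize (fun H' => H H' y 0); cbv beta in H.
    rewrite Rplus_0_l, HF0 in H.
    enough (F (y + PI) - F y = F PI - 0) by lra.
    apply H; intros t.
    replace 0 with (1 * f (t + PI) - f t) by (rewrite Hper; ring).
    apply (is_derive_minus (V := R_NormedModule)); [| apply HF].
    apply (is_derive_comp F (fun t => t + PI)); [apply HF |].
    auto_derive; trivial; ring. }
  assert (Hrefl : F (PI / 2) + F (PI / 2) = F PI).
  { assert (H := constant_of_zero_derivative (fun t => F t + F (PI - t))).
    specialize (fun H' => H H' (PI / 2) 0); cbv beta in H.
    replace (PI - PI / 2) with (PI / 2) in H by field.
    rewrite HF0, Rminus_0_r, Rplus_0_l in H.
    apply H; intros t.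
    replace 0 with (f t + (-1) * f (PI - t)).
    2: { replace (PI - t) with (- t + PI) by ring; rewrite Hper, Heven; ring. }
    apply (is_derive_plus (V := R_NormedModule)); [apply HF |].
    apply (is_derive_comp F (fun t => PI - t)); [apply HF |].
    auto_derive; trivial; ring. }
  replace (x + 2 * PI) with (x + PI + PI) by ring.
  rewrite !Hshift; lra.
Qed.

Lemma is_derive_asin (x : R) :
  -1 < x < 1 -> is_derive asin x (/ sqrt (1 - x ^ 2)).
Proof.
  intros Hx; apply is_derive_Reals.
  replace (/ sqrt (1 - x ^ 2)) with (derive_pt asin x (derivable_pt_asin x Hx)).
  - apply (proj2_sig (derivable_pt_asin x Hx)).
  - rewrite derive_pt_asin.
    replace (x²) with (x ^ 2) by (unfold Rsqr; ring).
    unfold Rdiv; ring.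
Qed.

(** The derivative of [asin] blows up at [1], so continuity comes from
    monotonicity of [sin] instead: if [sin (PI / 2 - e) < x <= 1] then
    [PI / 2 - e < asin x]; beyond [1] the function is constantly [PI / 2]. *)
Lemma continuous_asin_1 : continuous asin 1.
Proof.
  intros P [eps HP]; unfold filtermap.
  set (e := Rmin eps 1 / 2).
  assert (He : 0 < e < eps /\ e < 1).
  { unfold e; destruct eps as [eps Heps]; simpl.
    generalize (Rmin_l eps 1) (Rmin_r eps 1).
    assert (0 < Rmin eps 1) by (apply Rmin_glb_lt; lra); lra. }
  assert (HPI := PI2_1).
  assert (Hs : sin (PI / 2 - e) < 1).
  { rewrite <- sin_PI2; apply sin_increasing_1; lra. }
  assert (Hd : 0 < 1 - sin (PI / 2 - e)) by lra.
  assert (Hs0 : 0 < sin (PI / 2 - e)) by (apply sin_gt_0; lra).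
  exists (mkposreal _ Hd); intros x Hx; apply HP.
  unfold ball in *; simpl in *.
  unfold AbsRing_ball, abs, minus, plus, opp in *; simpl in *.
  rewrite asin_1.
  assert (Hb := asin_bound x).
  enough (PI / 2 - e < asin x) by (apply Rabs_def1; lra).
  apply Rabs_def2 in Hx.
  destruct (Rle_dec x 1) as [H1 | H1].
  - apply sin_increasing_0; try lra.
    rewrite sin_asin by lra; lra.
  - unfold asin.
    destruct (Rle_dec x (-1)); [lra |].
    destruct (Rle_dec 1 x); lra.
Qed.

(** * Exponentials and hyperbolic functions *)

Lemma exp_mult_opp (u : R) : exp u * exp (- u) = 1.
Proof. rewrite <- exp_plus, Rplus_opp_r; apply exp_0. Qed.

Lemma cosh_sinh_sq (x : R) : cosh x ^ 2 = 1 + sinh x ^ 2.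
Proof.
  unfold cosh, sinh.
  assert (H := exp_mult_opp x).
  field_simplify; lra.
Qed.

Lemma cosh_double (x : R) : cosh (2 * x) = 1 + 2 * sinh x ^ 2.
Proof.
  unfold cosh, sinh.
  assert (H := exp_mult_opp x).
  replace (- (2 * x)) with (- x + - x) by ring.
  replace (2 * x) with (x + x) by ring.
  rewrite !exp_plus; field_simplify; lra.
Qed.

Lemma one_minus_cosh_double (c A u : R) :
  c * cosh (2 * A) = 1 ->
  1 - c * cosh (2 * u) = 2 * c * (sinh A ^ 2 - sinh u ^ 2).
Proof. intros H; rewrite <- H, !cosh_double; ring. Qed.

Lemma sinh_double (x : R) : sinh (2 * x) = 2 * sinh x * cosh x.
Proof.
  unfold cosh, sinh.
  replace (- (2 * x)) with (- x + - x) by ring.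
  replace (2 * x) with (x + x) by ring.
  rewrite !exp_plus; field.
Qed.

Lemma cosh_pos (x : R) : 0 < cosh x.
Proof. unfold cosh; generalize (exp_pos x) (exp_pos (- x)); lra. Qed.

Lemma sqrt_one_plus_sinh_sq (x : R) : sqrt (1 + sinh x ^ 2) = cosh x.
Proof.
  rewrite <- cosh_sinh_sq.
  apply sqrt_pow2, Rlt_le, cosh_pos.
Qed.

Lemma sinh_inj (x y : R) : sinh x = sinh y -> x = y.
Proof. intros H; rewrite <- (arcsinh_sinh x), H; apply arcsinh_sinh. Qed.

(** * The phase density and its integral over heights *)

(** The time integrand [w (sinh^2 zeta) dt] expressed in the phase [theta], where
    [sinh zeta = sinh A sin theta] and [dt = d theta / (sqrt (2c) cosh zeta)]. *)
Definition phase_density (c A : R) (w : R -> R) (theta : R) : R :=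
  w ((sinh A * sin theta) ^ 2)
  / (sqrt (2 * c) * sqrt (1 + (sinh A * sin theta) ^ 2)).

Lemma one_plus_sq_pos (u : R) : 0 < 1 + u ^ 2.
Proof. generalize (pow2_ge_0 u); lra. Qed.

Lemma continuous_phase_density (c A : R) (w : R -> R) (theta : R) :
  0 < c -> (forall u, continuous w u) ->
  continuous (phase_density c A w) theta.
Proof.
  intros Hc Hw; unfold phase_density.
  apply (continuous_mult
    (fun t => w ((sinh A * sin t) ^ 2))
    (fun t => / (sqrt (2 * c) * sqrt (1 + (sinh A * sin t) ^ 2)))).
  - apply continuous_comp; [| apply Hw].
    apply (ex_derive_continuous (V := R_NormedModule)); auto_derive; trivial.
  - apply (ex_derive_continuous (V := R_NormedModule)).
    assert (H := one_plus_sq_pos (sinh A * sin theta)).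
    auto_derive; split.
    + simpl in H; exact H.
    + split; [| trivial].
      apply Rgt_not_eq, Rmult_lt_0_compat; apply sqrt_lt_R0; [lra | exact H].
Qed.

Lemma RInt_phase_density_add_2PI (c A : R) (w : R -> R) (theta : R) :
  0 < c -> (forall u, continuous w u) ->
  RInt (phase_density c A w) 0 (theta + 2 * PI) =
  RInt (phase_density c A w) 0 theta + 4 * RInt (phase_density c A w) 0 (PI / 2).
Proof.
  intros Hc Hw; apply RInt_add_2PI.
  - intros t; now apply continuous_phase_density.
  - intros t; unfold phase_density.
    replace ((sinh A * sin (t + PI)) ^ 2) with ((sinh A * sin t) ^ 2)
      by (rewrite neg_sin; ring).
    reflexivity.
  - intros t; unfold phase_density.
    replace ((sinh A * sin (- t)) ^ 2) with ((sinh A * sin t) ^ 2)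
      by (rewrite sin_neg; ring).
    reflexivity.
Qed.

(** The substitution [theta = asin (sinh zeta / sinh A)], which removes the
    singularity at [zeta = A]: there the radicand
    [1 - c cosh (2 zeta) = 2 c (sinh^2 A - sinh^2 zeta)] vanishes like
    [cos^2 theta], and so does the square of [d zeta / d theta]. *)
Lemma RInt_gen_height (c A : R) (w : R -> R) :
  0 < c -> 0 < A -> c * cosh (2 * A) = 1 ->
  (forall u, continuous w u) ->
  RInt_gen (fun zeta => w (sinh zeta ^ 2) / sqrt (1 - c * cosh (2 * zeta)))
    (at_point 0) (at_left A)
  = RInt (phase_density c A w) 0 (PI / 2).
Proof.
  intros Hc HA HcA Hw.
  assert (Hf : forall t, continuous (phase_density c A w) t)
    by (intros t; now apply continuous_phase_density).
  assert (HF := fun x => is_derive_RInt_continuous _ x Hf).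
  set (F := RInt (phase_density c A w) 0) in *.
  assert (HF0 : F 0 = 0) by apply (RInt_point (V := R_CompleteNormedModule)).
  assert (Hs : 0 < sinh A) by (rewrite <- sinh_0; now apply sinh_lt).
  set (theta := fun zeta => asin (sinh zeta / sinh A)).
  assert (Hradicand := fun u => one_minus_cosh_double c A u HcA).
  assert (Hrange : forall zeta, 0 <= zeta < A -> 0 <= sinh zeta < sinh A).
  { intros zeta Hz; split; [| now apply sinh_lt].
    destruct (Req_dec zeta 0) as [-> | Hz0]; [rewrite sinh_0; lra |].
    rewrite <- sinh_0; left; apply sinh_lt; lra. }
  apply is_RInt_gen_unique.
  replace (F (PI / 2)) with (F (PI / 2) - F (theta 0)).
  2: { unfold theta; rewrite sinh_0; unfold Rdiv at 2; rewrite Rmult_0_l, asin_0; lra. }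
  apply (is_RInt_gen_antiderivative (fun zeta => F (theta zeta))); trivial.
  - intros zeta Hz; specialize (Hrange zeta Hz).
    assert (Hq : 0 <= sinh zeta / sinh A < 1).
    { split; [apply Rdiv_le_0_compat; lra |].
      apply Rmult_lt_reg_r with (sinh A); trivial.
      unfold Rdiv; rewrite Rmult_assoc, Rinv_l; lra. }
    assert (Hgap : 0 < sinh A ^ 2 - sinh zeta ^ 2) by nra.
    evar (l : R).
    assert (Hd : is_derive (fun zeta => F (theta zeta)) zeta l).
    { apply (is_derive_comp F theta); [apply HF |].
      apply (is_derive_comp asin (fun zeta => sinh zeta / sinh A)).
      - apply is_derive_asin; lra.
      - apply (is_derive_ext (fun zeta => / sinh A * sinh zeta));
          [intros t; apply Rmult_comm |].
        apply (is_derive_scal sinh).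
        apply is_derive_Reals, derivable_pt_lim_sinh. }
    unfold l in Hd.
    match type of Hd with is_derive _ _ ?d =>
      replace (w (sinh zeta ^ 2) / sqrt (1 - c * cosh (2 * zeta))) with d end;
      trivial.
    change (/ sinh A * cosh zeta * / sqrt (1 - (sinh zeta / sinh A) ^ 2)
            * phase_density c A w (theta zeta)
            = w (sinh zeta ^ 2) / sqrt (1 - c * cosh (2 * zeta))).
    unfold phase_density, theta.
    rewrite sin_asin by lra.
    replace (sinh A * (sinh zeta / sinh A)) with (sinh zeta) by (field; lra).
    rewrite sqrt_one_plus_sinh_sq.
    rewrite Hradicand, (sqrt_mult (2 * c)) by lra.
    replace (1 - (sinh zeta / sinh A) ^ 2)
      with ((sinh A ^ 2 - sinh zeta ^ 2) / (sinh A ^ 2)) by (field; lra).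
    rewrite sqrt_div, sqrt_pow2 by nra.
    assert (0 < sqrt (2 * c)) by (apply sqrt_lt_R0; lra).
    assert (0 < sqrt (sinh A ^ 2 - sinh zeta ^ 2)) by (now apply sqrt_lt_R0).
    assert (Hch := cosh_pos zeta).
    field; repeat split; lra.
  - intros zeta Hz; specialize (Hrange zeta Hz).
    assert (Hgap : 0 < sinh A ^ 2 - sinh zeta ^ 2) by nra.
    apply (continuous_mult (fun zeta => w (sinh zeta ^ 2))
             (fun zeta => / sqrt (1 - c * cosh (2 * zeta)))).
    + apply continuous_comp; [| apply Hw].
      apply (ex_derive_continuous (V := R_NormedModule)).
      unfold sinh; auto_derive; trivial.
    + apply (ex_derive_continuous (V := R_NormedModule)).
      assert (Hpos : 0 < 1 - c * cosh (2 * zeta))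
        by (rewrite Hradicand; apply Rmult_lt_0_compat; lra).
      assert (Hsq := sqrt_lt_R0 _ Hpos).
      unfold cosh in *; auto_derive; repeat split; trivial.
      exact (Rgt_not_eq _ _ Hsq).
  - replace (PI / 2) with (theta A)
      by (unfold theta, Rdiv; rewrite Rinv_r by lra; apply asin_1).
    enough (Hcont : continuous (fun zeta => F (theta zeta)) A).
    { exact (filterlim_filter_le_1 _ (filter_le_within _) Hcont). }
    apply (continuous_comp theta F).
    + apply (continuous_comp (fun zeta => sinh zeta / sinh A) asin).
      * apply (ex_derive_continuous (V := R_NormedModule)).
        unfold sinh at 1; auto_derive; trivial.
      * unfold Rdiv; rewrite Rinv_r by lra; apply continuous_asin_1.
    + apply (ex_derive_continuous (V := R_NormedModule)).
      eexists; apply HF.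
Qed.

(** * The oscillator *)

Lemma exists_angle (p q : R) :
  p ^ 2 + q ^ 2 = 1 -> exists theta, p = cos theta /\ q = sin theta.
Proof.
  intros H.
  assert (Hp : -1 <= p <= 1) by nra.
  assert (Hsin : sin (acos p) = Rabs q).
  { rewrite sin_acos by trivial.
    replace (1 - p²) with (q²) by (unfold Rsqr; lra).
    apply sqrt_Rsqr_abs. }
  destruct (Rle_dec 0 q) as [Hq | Hq].
  - exists (acos p); rewrite cos_acos, Hsin, Rabs_right by lra; lra.
  - exists (- acos p); rewrite cos_neg, sin_neg, cos_acos, Hsin, Rabs_left by lra; lra.
Qed.

(** The reduced motion: [zeta] is the height above the average height and [eta]
    the vertical velocity. *)
Definition oscillation (c : R) (zeta eta : R -> R) : Prop :=
  (forall t, is_derive zeta t (eta t)) /\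
  (forall t, is_derive eta t (- c * sinh (2 * zeta t))) /\
  (forall t, eta t ^ 2 = 1 - c * cosh (2 * zeta t)).

Definition is_phase (c A : R) (zeta eta theta : R -> R) : Prop :=
  forall t,
    is_derive theta t (sqrt (2 * c) * cosh (zeta t)) /\
    sinh (zeta t) = sinh A * sin (theta t) /\
    eta t = sqrt (2 * c) * sinh A * cos (theta t).

(** The normalized point [(p, q)] runs on the unit circle and rotates with angular
    velocity [sqrt (2c) cosh zeta].  Integrating that velocity from an angle of
    the initial point gives [theta]; the scalar product of [(p, q)] with
    [(cos theta, sin theta)] is then constantly [1], so the two unit vectors
    agree at all times, with no continuous choice of an argument. *)
Lemma exists_phase (c A : R) (zeta eta : R -> R) :
  0 < c -> 0 < A -> c * cosh (2 * A) = 1 ->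
  oscillation c zeta eta -> exists theta, is_phase c A zeta eta theta.
Proof.
  intros Hc HA HcA (Hzeta & Heta & Henergy).
  assert (Hs : 0 < sinh A) by (rewrite <- sinh_0; now apply sinh_lt).
  assert (Hr : 0 < sqrt (2 * c)) by (apply sqrt_lt_R0; lra).
  assert (Hr2 : sqrt (2 * c) * sqrt (2 * c) = 2 * c) by (apply sqrt_sqrt; lra).
  set (r := sqrt (2 * c)) in *.
  set (s := sinh A) in *.
  set (p := fun t => eta t / (r * s)).
  set (q := fun t => sinh (zeta t) / s).
  assert (Hcircle : forall t, p t ^ 2 + q t ^ 2 = 1).
  { intros t; unfold p, q.
    replace ((eta t / (r * s)) ^ 2) with (eta t ^ 2 / (r * r * s ^ 2))
      by (field; lra).
    rewrite Henergy, Hr2, (one_minus_cosh_double c A) by trivial; fold s.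
    field; lra. }
  destruct (exists_angle _ _ (Hcircle 0)) as (theta0 & Hp0 & Hq0).
  set (speed := fun t => r * cosh (zeta t)).
  assert (Hspeed : forall t, continuous speed t).
  { intros t.
    apply (continuous_scal_r (V := R_NormedModule) r (fun t => cosh (zeta t))).
    apply (continuous_comp zeta cosh);
      apply (ex_derive_continuous (V := R_NormedModule)).
    - eexists; apply Hzeta.
    - eexists; apply is_derive_Reals, derivable_pt_lim_cosh. }
  set (theta := fun t => theta0 + RInt speed 0 t).
  assert (Htheta : forall t, is_derive theta t (speed t)).
  { intros t; unfold theta.
    rewrite <- (Rplus_0_l (speed t)).
    apply (is_derive_plus (V := R_NormedModule)).
    - apply (is_derive_const (V := R_NormedModule)).
    - now apply is_derive_RInt_continuous. }
  assert (Hone : forall t, p t * cos (theta t) + q t * sin (theta t) = 1).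
  { intros t.
    transitivity (p 0 * cos (theta 0) + q 0 * sin (theta 0)).
    - apply (constant_of_zero_derivative
               (fun t => p t * cos (theta t) + q t * sin (theta t))).
      clear t; intros t; unfold p, q.
      auto_derive.
      + repeat split; eexists; [apply Heta | apply Htheta | apply Hzeta | apply Htheta].
      + replace (Derive (fun x => eta x) t) with (- c * sinh (2 * zeta t))
          by (symmetry; apply is_derive_unique, Heta).
        replace (Derive (fun x => theta x) t) with (speed t)
          by (symmetry; apply is_derive_unique, Htheta).
        replace (Derive (fun x => zeta x) t) with (eta t)
          by (symmetry; apply is_derive_unique, Hzeta).
        unfold speed; rewrite sinh_double.
        replace c with (r * r / 2) by lra.
        field; lra.
    - unfold theta at 1 2.
      replace (RInt speed 0 0) with 0
        by (symmetry; apply (RInt_point (V := R_CompleteNormedModule))).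
      rewrite Rplus_0_r, <- Hp0, <- Hq0.
      rewrite <- (Hcircle 0); ring. }
  exists theta; intros t; split; [apply Htheta |].
  assert (Hunit := sin2_cos2 (theta t)); unfold Rsqr in Hunit.
  assert (Hdist : (p t - cos (theta t))² + (q t - sin (theta t))² = 0).
  { generalize (Hcircle t) (Hone t); unfold Rsqr; lra. }
  apply Rplus_sqr_eq_0 in Hdist as [Hp Hq].
  apply Rminus_diag_uniq in Hp, Hq.
  fold r s; rewrite <- Hp, <- Hq; unfold p, q; split; field; lra.
Qed.

Lemma is_derive_phase_integral (c A : R) (zeta eta theta w : R -> R) (t : R) :
  0 < c -> (forall u, continuous w u) -> is_phase c A zeta eta theta ->
  is_derive (fun t => RInt (phase_density c A w) 0 (theta t)) t (w (sinh (zeta t) ^ 2)).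
Proof.
  intros Hc Hw Hphase; destruct (Hphase t) as (Htheta & Hsinh & _).
  assert (Hr : 0 < sqrt (2 * c)) by (apply sqrt_lt_R0; lra).
  replace (w (sinh (zeta t) ^ 2))
    with (sqrt (2 * c) * cosh (zeta t) * phase_density c A w (theta t)).
  - apply (is_derive_comp (RInt (phase_density c A w) 0) theta); trivial.
    apply is_derive_RInt_continuous; intros; now apply continuous_phase_density.
  - unfold phase_density; rewrite <- Hsinh, sqrt_one_plus_sinh_sq.
    assert (H := cosh_pos (zeta t)); field; lra.
Qed.

Lemma phase_density_pos (c A : R) (w : R -> R) (theta : R) :
  0 < c -> (forall u, 0 <= u -> 0 < w u) -> 0 < phase_density c A w theta.
Proof.
  intros Hc Hw; apply Rdiv_lt_0_compat; [apply Hw, pow2_ge_0 |].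
  apply Rmult_lt_0_compat; apply sqrt_lt_R0; [lra | apply one_plus_sq_pos].
Qed.

(** With weight [1] the phase integral [G] is time itself, up to a constant.  So
    both [theta (t + T)] and [theta t + 2 PI] have the value
    [G (theta t) + T], and [G] is injective because its derivative, the density,
    is positive. *)
Lemma phase_advance (c A : R) (zeta eta theta : R -> R) (t : R) :
  0 < c -> is_phase c A zeta eta theta ->
  theta (t + 4 * RInt (phase_density c A (fun _ => 1)) 0 (PI / 2))
  = theta t + 2 * PI.
Proof.
  intros Hc Hphase.
  set (w := fun _ : R => 1).
  assert (Hw : forall u, continuous w u) by (intros u; apply continuous_const).
  set (G := RInt (phase_density c A w) 0).
  set (T := 4 * G (PI / 2)).
  assert (HG : G (theta (t + T)) = G (theta t + 2 * PI)).
  { assert (Htime := constant_of_zero_derivative (fun t => G (theta t) - t)).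
    specialize (fun H => Htime H (t + T) t); cbv beta in Htime.
    unfold G at 2; rewrite RInt_phase_density_add_2PI by trivial; fold G T.
    enough (G (theta (t + T)) - (t + T) = G (theta t) - t) by lra.
    apply Htime; intros u.
    replace 0 with (w (sinh (zeta u) ^ 2) - 1) by (unfold w; ring).
    apply (is_derive_minus (V := R_NormedModule)).
    - now apply is_derive_phase_integral with eta.
    - apply (is_derive_id (K := R_AbsRing)). }
  destruct (MVT_gen G (theta (t + T)) (theta t + 2 * PI) (phase_density c A w))
    as (x & _ & Hx).
  - intros x _; apply is_derive_RInt_continuous; intros; now apply continuous_phase_density.
  - intros x _; apply continuity_pt_filterlim.
    apply (ex_derive_continuous (V := R_NormedModule) G); eexists.
    apply is_derive_RInt_continuous; intros; now apply continuous_phase_density.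
  - assert (Hpos := phase_density_pos c A w x Hc (fun _ _ => Rlt_0_1)).
    rewrite HG in Hx.
    fold w G T.
    apply Rmult_eq_reg_l with (phase_density c A w x); lra.
Qed.

(** [J] is the time integral of [cosh (2 zeta)], defined through the phase so that
    its increment over a period can be read off. *)
Lemma oscillation_periodic (c A : R) (zeta eta : R -> R) :
  0 < c -> 0 < A -> c * cosh (2 * A) = 1 -> oscillation c zeta eta ->
  let T := 4 * RInt_gen (fun u => 1 / sqrt (1 - c * cosh (2 * u)))
                 (at_point 0) (at_left A) in
  let M := 4 * RInt_gen (fun u => cosh (2 * u) / sqrt (1 - c * cosh (2 * u)))
                 (at_point 0) (at_left A) in
  0 <= M /\
  (forall t, zeta (t + T) = zeta t) /\
  (forall t, eta (t + T) = eta t) /\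
  exists J : R -> R,
    (forall t, is_derive J t (cosh (2 * zeta t))) /\
    (forall t, J (t + T) = J t + M).
Proof.
  intros Hc HA HcA Hosc T M.
  destruct (exists_phase c A zeta eta Hc HA HcA Hosc) as [theta Hphase].
  (* This weight takes the value [cosh (2 zeta)] at [sinh^2 zeta]. *)
  set (w := fun u => 1 + 2 * u).
  assert (Hw : forall u, continuous w u).
  { intros u; apply (ex_derive_continuous (V := R_NormedModule)).
    unfold w; auto_derive; trivial. }
  assert (HT : T = 4 * RInt (phase_density c A (fun _ => 1)) 0 (PI / 2)).
  { unfold T; f_equal.
    apply (RInt_gen_height c A (fun _ => 1)); trivial.
    intros u; apply continuous_const. }
  assert (HM : M = 4 * RInt (phase_density c A w) 0 (PI / 2)).
  { unfold M; f_equal.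
    rewrite <- (RInt_gen_height c A w) by trivial.
    f_equal; apply functional_extensionality; intros u.
    now rewrite cosh_double. }
  assert (Hadv : forall t, theta (t + T) = theta t + 2 * PI)
    by (intros t; rewrite HT; now apply phase_advance with zeta eta).
  split; [| split; [| split]].
  - assert (HPI := PI2_1).
    rewrite HM; apply Rmult_le_pos; [lra |].
    apply RInt_ge_0; [lra | |].
    + apply (ex_RInt_continuous (V := R_CompleteNormedModule)).
      intros x _; now apply continuous_phase_density.
    + intros x _; left; apply phase_density_pos; trivial.
      intros u Hu; unfold w; lra.
  - intros t.
    destruct (Hphase t) as (_ & Ht & _), (Hphase (t + T)) as (_ & HtT & _).
    rewrite Hadv, sin_plus, sin_2PI, cos_2PI in HtT.
    apply sinh_inj; lra.
  - intros t.
    destruct (Hphase t) as (_ & _ & ->), (Hphase (t + T)) as (_ & _ & ->).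
    rewrite Hadv, cos_plus, sin_2PI, cos_2PI; ring.
  - exists (fun t => RInt (phase_density c A w) 0 (theta t)); split; intros t.
    + rewrite cosh_double.
      exact (is_derive_phase_integral c A zeta eta theta w t Hc Hw Hphase).
    + rewrite Hadv, RInt_phase_density_add_2PI by trivial; lra.
Qed.

(** * The geodesic equations *)

Lemma partial_metric (l i j : axis) (p : point) :
  partial l (fun q => metric q i j) p =
  match l, i, j with
  | Oz, Ox, Ox => -2 * exp (- 2 * coord Oz p)
  | Oz, Oy, Oy => 2 * exp (2 * coord Oz p)
  | _, _, _ => 0
  end.
Proof.
  destruct p as [[x y] z]; unfold partial, metric.
  apply is_derive_unique.
  destruct l, i, j; try apply is_derive_const; cbn;
    unfold plus, scal; simpl; unfold mult; simpl;
    auto_derive; trivial; rewrite ?Rmult_0_l, ?Rplus_0_r; ring.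
Qed.

(** The metric is diagonal and depends on [z] alone, so the only Christoffel terms
    in the equations of [x] and [y] are cross terms with [z'].  This makes both
    equations linear in the horizontal velocity, hence integrable. *)
Lemma geodesic_acceleration (gamma : R -> point) (i : axis) (t : R) :
  is_geodesic gamma ->
  Derive (velocity gamma i) t =
  match i with
  | Ox => 2 * velocity gamma Oz t * velocity gamma Ox t
  | Oy => - 2 * velocity gamma Oz t * velocity gamma Oy t
  | Oz => exp (2 * coord Oz (gamma t)) * velocity gamma Oy t ^ 2
          - exp (- 2 * coord Oz (gamma t)) * velocity gamma Ox t ^ 2
  end.
Proof.
  intros Hgeo; destruct (Hgeo i t) as (_ & _ & H).
  unfold sum_axis, christoffel, sum_axis in H.
  rewrite !partial_metric in H.
  assert (Hexp : exp (- 2 * coord Oz (gamma t)) * exp (2 * coord Oz (gamma t)) = 1).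
  { rewrite <- exp_plus, <- exp_0; f_equal; ring. }
  set (E := exp (2 * coord Oz (gamma t))) in *.
  set (E' := exp (- 2 * coord Oz (gamma t))) in *.
  destruct i; cbn [inverse_metric] in H; fold E E' in H.
  - replace (2 * velocity gamma Oz t * velocity gamma Ox t)
      with (E' * E * 2 * velocity gamma Oz t * velocity gamma Ox t)
      by (rewrite Hexp; ring).
    lra.
  - replace (- 2 * velocity gamma Oz t * velocity gamma Oy t)
      with (E' * E * (- 2) * velocity gamma Oz t * velocity gamma Oy t)
      by (rewrite Hexp; ring).
    lra.
  - lra.
Qed.

Lemma is_derive_coord (gamma : R -> point) (i : axis) (t : R) :
  is_geodesic gamma -> is_derive (fun s => coord i (gamma s)) t (velocity gamma i t).
Proof. intros Hgeo; destruct (Hgeo i t) as (H & _ & _); exact (Derive_correct _ _ H). Qed.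

Lemma is_derive_velocity (gamma : R -> point) (i : axis) (t : R) :
  is_geodesic gamma -> is_derive (velocity gamma i) t (Derive (velocity gamma i) t).
Proof. intros Hgeo; destruct (Hgeo i t) as (_ & H & _); exact (Derive_correct _ _ H). Qed.

(** Used with [k = 2] for [x'] and [k = -2] for [y']: the conserved quantities [a]
    and [b] are the values of the integrating factor times the velocity. *)
Lemma exp_integrating_factor (k : R) (z z' v : R -> R) :
  (forall t, is_derive z t (z' t)) ->
  (forall t, is_derive v t (k * z' t * v t)) ->
  forall t, v t = exp (- k * z 0) * v 0 * exp (k * z t).
Proof.
  intros Hz Hv t.
  rewrite (constant_of_zero_derivative (fun t => exp (- k * z t) * v t)) with (t := t).
  - rewrite <- (Rmult_1_l (v t)) at 1; rewrite <- (exp_mult_opp (k * z t)).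
    replace (- (k * z t)) with (- k * z t); ring.
  - clear t; intros t; auto_derive.
    + repeat split; eexists; [apply Hz | apply Hv].
    + replace (Derive (fun x => z x) t) with (z' t)
        by (symmetry; apply is_derive_unique, Hz).
      replace (Derive (fun x => v x) t) with (k * z' t * v t)
        by (symmetry; apply is_derive_unique, Hv).
      ring.
Qed.

Lemma velocity_Ox (gamma : R -> point) (t : R) :
  is_geodesic gamma ->
  velocity gamma Ox t = motion_a gamma * exp (2 * coord Oz (gamma t)).
Proof.
  intros Hgeo.
  apply (exp_integrating_factor 2 (fun s => coord Oz (gamma s)) (velocity gamma Oz)).
  - intros s; now apply is_derive_coord.
  - intros s; rewrite <- (geodesic_acceleration gamma Ox) by trivial.
    now apply is_derive_velocity.
Qed.

Lemma velocity_Oy (gamma : R -> point) (t : R) :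
  is_geodesic gamma ->
  velocity gamma Oy t = motion_b gamma * exp (- (2 * coord Oz (gamma t))).
Proof.
  intros Hgeo; unfold motion_b.
  replace (- (2 * coord Oz (gamma t))) with (-2 * coord Oz (gamma t)) by ring.
  replace (2 * coord Oz (gamma 0)) with (- -2 * coord Oz (gamma 0)) by ring.
  apply (exp_integrating_factor (-2) (fun s => coord Oz (gamma s)) (velocity gamma Oz)).
  - intros s; now apply is_derive_coord.
  - intros s; rewrite <- (geodesic_acceleration gamma Oy) by trivial.
    now apply is_derive_velocity.
Qed.

(** * The average height and the amplitude *)

Lemma exp_double_average_height (a b : R) :
  a <> 0 -> b <> 0 -> exp (2 * average_height a b) = Rabs b / Rabs a.
Proof.
  intros Ha Hb; unfold average_height.
  replace (2 * (/ 2 * ln (Rabs (b / a)))) with (ln (Rabs (b / a))) by field.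
  rewrite exp_ln; [now apply Rabs_div |].
  apply Rabs_pos_lt; unfold Rdiv.
  apply Rmult_integral_contrapositive_currified; trivial.
  now apply Rinv_neq_0_compat.
Qed.

(** The average height is chosen so that [e^(2h) = |b| / |a|], which balances the
    two exponentials [|a| e^(2z)] and [|b| e^(-2z)]. *)
Lemma exp_height (a b z : R) :
  a <> 0 -> b <> 0 ->
  let zeta := z - average_height a b in
  Rabs a * exp (2 * z) = Rabs b * exp (2 * zeta) /\
  Rabs b * exp (- (2 * z)) = Rabs a * exp (- (2 * zeta)).
Proof.
  intros Ha Hb zeta.
  assert (Hh := exp_double_average_height a b Ha Hb).
  assert (Hh' := exp_mult_opp (2 * average_height a b)).
  rewrite Hh in Hh'.
  assert (Ha' := Rabs_pos_lt a Ha); assert (Hb' := Rabs_pos_lt b Hb).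
  replace (2 * z) with (2 * zeta + 2 * average_height a b) by (unfold zeta; ring).
  rewrite Ropp_plus_distr, !exp_plus, Hh; split; [field; lra |].
  replace (exp (- (2 * average_height a b))) with (Rabs a / Rabs b); [field; lra |].
  apply Rmult_eq_reg_l with (Rabs b / Rabs a).
  - rewrite Hh'; field; lra.
  - apply Rgt_not_eq, Rdiv_lt_0_compat; lra.
Qed.

Lemma sign_mult_abs (u : R) : sign u * Rabs u = u.
Proof.
  destruct (Rtotal_order u 0) as [H | [-> | H]].
  - rewrite sign_eq_m1, Rabs_left by lra; ring.
  - rewrite Rabs_R0; ring.
  - rewrite sign_eq_1, Rabs_right by lra; ring.
Qed.

Lemma sign_sq (u : R) : u <> 0 -> sign u ^ 2 = 1.
Proof.
  intros Hu; destruct (Rtotal_order u 0) as [H | [H | H]]; [| easy |].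
  - rewrite sign_eq_m1 by trivial; ring.
  - rewrite sign_eq_1 by trivial; ring.
Qed.

Lemma sign_mult_self (u : R) : sign u * u = Rabs u.
Proof.
  destruct (Rtotal_order u 0) as [H | [-> | H]].
  - rewrite sign_eq_m1, Rabs_left by lra; ring.
  - rewrite Rabs_R0; ring.
  - rewrite sign_eq_1, Rabs_right by lra; ring.
Qed.

Lemma horizontal_velocity (gamma : R -> point) (t : R) :
  is_geodesic gamma -> motion_a gamma <> 0 -> motion_b gamma <> 0 ->
  let a := motion_a gamma in
  let b := motion_b gamma in
  let zeta := coord Oz (gamma t) - average_height a b in
  velocity gamma Ox t = sign (a * b) * b * (cosh (2 * zeta) + sinh (2 * zeta)) /\
  velocity gamma Oy t = sign (a * b) * a * (cosh (2 * zeta) - sinh (2 * zeta)).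
Proof.
  intros Hgeo Ha Hb a b zeta; fold a in Ha; fold b in Hb.
  rewrite velocity_Ox, velocity_Oy by trivial; fold a b.
  destruct (exp_height a b (coord Oz (gamma t)) Ha Hb) as [Hx Hy]; fold zeta in Hx, Hy.
  replace (sign (a * b) * b) with (sign a * Rabs b)
    by (rewrite sign_mult, <- (sign_mult_self b); ring).
  replace (sign (a * b) * a) with (sign b * Rabs a)
    by (rewrite sign_mult, <- (sign_mult_self a); ring).
  replace (cosh (2 * zeta) + sinh (2 * zeta)) with (exp (2 * zeta))
    by (unfold cosh, sinh; field).
  replace (cosh (2 * zeta) - sinh (2 * zeta)) with (exp (- (2 * zeta)))
    by (unfold cosh, sinh; field).
  rewrite (Rmult_assoc (sign a)), (Rmult_assoc (sign b)), <- Hx, <- Hy.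
  rewrite <- !Rmult_assoc, !sign_mult_abs; split; reflexivity.
Qed.

Lemma cosh_height (a b z : R) :
  a <> 0 -> b <> 0 ->
  a ^ 2 * exp (2 * z) + b ^ 2 * exp (- (2 * z))
  = 2 * Rabs (a * b) * cosh (2 * (z - average_height a b)).
Proof.
  intros Ha Hb; destruct (exp_height a b z Ha Hb) as [Hx Hy].
  rewrite <- (pow2_abs a), <- (pow2_abs b), Rabs_mult; unfold cosh.
  transitivity (Rabs a * (Rabs a * exp (2 * z)) + Rabs b * (Rabs b * exp (- (2 * z))));
    [ring |].
  rewrite Hx, Hy; field.
Qed.

Lemma sqrt_eq_1 (u : R) : sqrt u = 1 -> u = 1.
Proof.
  intros H; destruct (Rle_dec 0 u) as [Hu | Hu].
  - rewrite <- (sqrt_sqrt u Hu), H; ring.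
  - rewrite sqrt_neg_0 in H; lra.
Qed.

(** Unit speed reads [z'^2 + a^2 e^(2z) + b^2 e^(-2z) = 1], which [cosh_height]
    turns into the energy level. *)
Lemma geodesic_oscillation (gamma : R -> point) :
  is_geodesic gamma -> unit_speed gamma ->
  motion_a gamma <> 0 -> motion_b gamma <> 0 ->
  let a := motion_a gamma in
  let b := motion_b gamma in
  oscillation (2 * Rabs (a * b))
    (fun t => coord Oz (gamma t) - average_height a b) (velocity gamma Oz).
Proof.
  intros Hgeo Hspeed Ha Hb a b; fold a in Ha; fold b in Hb.
  split; [| split]; intros t.
  - rewrite <- (Rminus_0_r (velocity gamma Oz t)).
    apply (is_derive_minus (V := R_NormedModule)).
    + now apply is_derive_coord.
    + apply (is_derive_const (V := R_NormedModule)).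
  - assert (Hv := is_derive_velocity gamma Oz t Hgeo).
    rewrite geodesic_acceleration, velocity_Ox, velocity_Oy in Hv by trivial.
    fold a b in Hv.
    set (z := coord Oz (gamma t)) in *.
    replace (- (2 * Rabs (a * b)) * sinh (2 * (z - average_height a b)))
      with (exp (2 * z) * (b * exp (- (2 * z))) ^ 2
            - exp (- 2 * z) * (a * exp (2 * z)) ^ 2); trivial.
    destruct (exp_height a b z Ha Hb) as [Hx Hy].
    replace (- 2 * z) with (- (2 * z)) by ring.
    assert (He := exp_mult_opp (2 * z)).
    transitivity (exp (2 * z) * exp (- (2 * z)) * (Rabs b ^ 2 * exp (- (2 * z))
      - Rabs a ^ 2 * exp (2 * z))); [rewrite !pow2_abs; ring |].
    rewrite He, Rmult_1_l, Rabs_mult; unfold sinh.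
    transitivity (Rabs b * (Rabs b * exp (- (2 * z))) - Rabs a * (Rabs a * exp (2 * z)));
      [ring |].
    rewrite Hx, Hy; field.
  - rewrite <- cosh_height by trivial.
    assert (H := Hspeed t).
    apply sqrt_eq_1 in H.
    unfold sum_axis in H; cbn [metric] in H.
    rewrite velocity_Ox, velocity_Oy in H by trivial; fold a b in H.
    replace (-2 * coord Oz (gamma t)) with (- (2 * coord Oz (gamma t))) in H by ring.
    assert (He := exp_mult_opp (2 * coord Oz (gamma t))).
    set (e := exp (2 * coord Oz (gamma t))) in *.
    set (e' := exp (- (2 * coord Oz (gamma t)))) in *.
    replace (a ^ 2 * e + b ^ 2 * e') with (e * e' * (a ^ 2 * e + b ^ 2 * e'))
      by (rewrite He; ring).
    rewrite <- H; ring.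
Qed.

(** If [c >= 1] the energy relation [eta^2 = 1 - c - 2 c sinh^2 zeta] leaves only
    [zeta = 0], so the height would be constant. *)
Lemma generic_lt_1 (gamma : R -> point) (c h : R) :
  is_generic gamma -> 0 < c ->
  oscillation c (fun t => coord Oz (gamma t) - h) (velocity gamma Oz) -> c < 1.
Proof.
  intros Hgen Hc (_ & _ & Henergy).
  apply Rnot_le_lt; intros H1.
  apply (Hgen Oz); exists h; intros t.
  assert (He := Henergy t); cbv beta in He.
  rewrite cosh_double in He.
  set (u := coord Oz (gamma t) - h) in *.
  assert (Hsinh : sinh u = 0).
  { assert (Hv := pow2_ge_0 (velocity gamma Oz t)).
    assert (Hs := pow2_ge_0 (sinh u)).
    assert (Hs0 : sinh u ^ 2 = 0) by nra.
    now apply Rsqr_0_uniq; unfold Rsqr; rewrite <- Hs0; ring_simplify. }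
  enough (u = 0) by (unfold u in *; lra).
  apply sinh_inj; now rewrite sinh_0.
Qed.

(** [A] is the turning value of [zeta]: from [tanh A = k] and [k^2 = (1 - c) / (1 + c)] one
    gets [cosh (2 A) = (1 + k^2) / (1 - k^2) = 1 / c]. *)
Lemma amplitude_spec (a b : R) :
  0 < 2 * Rabs (a * b) < 1 ->
  0 < amplitude a b /\ 2 * Rabs (a * b) * cosh (2 * amplitude a b) = 1.
Proof.
  intros Hc; unfold amplitude.
  assert (Hk2 : modulus a b ^ 2 = (1 - 2 * Rabs (a * b)) / (1 + 2 * Rabs (a * b))).
  { unfold modulus; apply pow2_sqrt, Rdiv_le_0_compat; lra. }
  assert (Hk0 : 0 < modulus a b).
  { unfold modulus; apply sqrt_lt_R0, Rdiv_lt_0_compat; lra. }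
  set (c := 2 * Rabs (a * b)) in *; set (k := modulus a b) in *.
  assert (Hkc : k ^ 2 * (1 + c) = 1 - c) by (rewrite Hk2; field; lra).
  assert (Hk1 : k < 1) by nra.
  assert (Htanh := tanh_artanh k ltac:(lra)).
  set (A := artanh k) in *.
  assert (Hcosh := cosh_pos A).
  assert (Hsinh : sinh A = k * cosh A).
  { rewrite <- Htanh; unfold tanh; field; lra. }
  split.
  - destruct (Rtotal_order A 0) as [H | [H | H]]; trivial; exfalso.
    + apply sinh_lt in H; rewrite sinh_0 in H; nra.
    + rewrite H, sinh_0 in Hsinh; rewrite H in Hcosh; nra.
  - assert (Hsq := cosh_sinh_sq A).
    rewrite cosh_double.
    rewrite Hsinh in *.
    apply Rmult_eq_reg_l with (1 + c); [| lra].
    transitivity (c * (1 + c) + 2 * c * (k ^ 2 * (1 + c)) * cosh A ^ 2); [ring |].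
    assert (H : (1 + c) * cosh A ^ 2 = 1 + c + (k ^ 2 * (1 + c)) * cosh A ^ 2).
    { rewrite Hsq at 1; ring. }
    rewrite Hkc in *; nra.
Qed.

(** Here [sinh (2 zeta)] integrates to [- eta / c], which is periodic, so only the
    hyperbolic cosine moves [x].  The coefficient [s] is [1] for the first
    coordinate of a geodesic and [-1] for the second. *)
Lemma coordinate_increment (k s c : R) (x J eta zeta : R -> R) (T M : R) :
  c <> 0 ->
  (forall t, is_derive J t (cosh (2 * zeta t))) ->
  (forall t, is_derive eta t (- c * sinh (2 * zeta t))) ->
  (forall t, is_derive x t (k * (cosh (2 * zeta t) + s * sinh (2 * zeta t)))) ->
  (forall t, J (t + T) = J t + M) ->
  (forall t, eta (t + T) = eta t) ->
  forall t, x (t + T) - x t = k * M.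
Proof.
  intros Hc HJ Heta Hx HJT HetaT t.
  assert (H := constant_of_zero_derivative
                 (fun t => x t - k * (J t - s / c * eta t))).
  specialize (fun H' => H H' (t + T) t); cbv beta in H.
  rewrite HJT, HetaT in H.
  enough (H' : forall t, is_derive (fun t => x t - k * (J t - s / c * eta t)) t 0)
    by (specialize (H H'); lra).
  clear - Hc HJ Heta Hx; intros t.
  auto_derive.
  - repeat split; eexists; [apply Hx | apply HJ | apply Heta].
  - replace (Derive (fun t => x t) t) with (k * (cosh (2 * zeta t) + s * sinh (2 * zeta t)))
      by (symmetry; apply is_derive_unique, Hx).
    replace (Derive (fun t => J t) t) with (cosh (2 * zeta t))
      by (symmetry; apply is_derive_unique, HJ).
    replace (Derive (fun t => eta t) t) with (- c * sinh (2 * zeta t))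
      by (symmetry; apply is_derive_unique, Heta).
    field; trivial.
Qed.

Lemma point_eq (p q : point) : (forall i, coord i p = coord i q) -> p = q.
Proof.
  intros H; destruct p as [[x y] z], q as [[x' y'] z'].
  generalize (H Ox) (H Oy) (H Oz); cbn; intros -> -> ->; reflexivity.
Qed.

Theorem theorem4p11 (gamma : R -> point) (a b : R)
  (Hgeodesic : is_geodesic gamma)
  (Hspeed : unit_speed gamma)
  (Hgeneric : is_generic gamma)
  (Ha : a = motion_a gamma)
  (Hb : b = motion_b gamma)
  (Ha0 : a <> 0)
  (Hb0 : b <> 0) :
  (forall t0 : R,
     coord Oz (gamma (t0 + period a b)) = coord Oz (gamma t0) /\
     minus (gamma (t0 + period a b)) (gamma t0) =
       scal (sign (a * b) * displacement a b) (b, a, 0)) /\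
  (forall t0 : R,
     horizontal_distance (gamma t0) (gamma (t0 + period a b)) =
       displacement a b *
       sqrt (2 * Rabs (a * b)
             * cosh (2 * (coord Oz (gamma t0) - average_height a b)))).
Proof.
  assert (Hosc : oscillation (2 * Rabs (a * b))
    (fun t => coord Oz (gamma t) - average_height a b) (velocity gamma Oz)).
  { rewrite Ha, Hb; apply geodesic_oscillation; trivial; congruence. }
  assert (Hv : forall t,
    let zeta := coord Oz (gamma t) - average_height a b in
    velocity gamma Ox t = sign (a * b) * b * (cosh (2 * zeta) + sinh (2 * zeta)) /\
    velocity gamma Oy t = sign (a * b) * a * (cosh (2 * zeta) - sinh (2 * zeta))).
  { intros t; rewrite Ha, Hb; apply horizontal_velocity; trivial; congruence. }
  clear Ha Hb.
  assert (Hc : 0 < 2 * Rabs (a * b)).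
  { apply Rmult_lt_0_compat; [lra |].
    now apply Rabs_pos_lt, Rmult_integral_contrapositive_currified. }
  assert (Hc1 := generic_lt_1 gamma _ _ Hgeneric Hc Hosc).
  destruct (amplitude_spec a b (conj Hc Hc1)) as [HA HcA].
  destruct (oscillation_periodic _ _ _ _ Hc HA HcA Hosc)
    as (HM & Hz & Heta & J & HJ & HJT).
  fold (period a b) in Hz, Heta, HJT.
  fold (displacement a b) in HM, HJT.
  destruct Hosc as (_ & Hderiv & _).
  assert (Hinc : forall t0,
    coord Ox (gamma (t0 + period a b)) - coord Ox (gamma t0)
      = sign (a * b) * b * displacement a b /\
    coord Oy (gamma (t0 + period a b)) - coord Oy (gamma t0)
      = sign (a * b) * a * displacement a b /\
    coord Oz (gamma (t0 + period a b)) = coord Oz (gamma t0)).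
  { intros t0; split; [| split].
    - apply (coordinate_increment _ 1 _ (fun t => coord Ox (gamma t)) J _ _ _ _
               (Rgt_not_eq _ _ Hc) HJ Hderiv); trivial.
      intros t; destruct (Hv t) as [Hx _].
      rewrite Rmult_1_l, <- Hx; now apply is_derive_coord.
    - apply (coordinate_increment _ (-1) _ (fun t => coord Oy (gamma t)) J _ _ _ _
               (Rgt_not_eq _ _ Hc) HJ Hderiv); trivial.
      intros t; destruct (Hv t) as [_ Hy].
      cbv beta; set (zeta := coord Oz (gamma t) - average_height a b) in *.
      replace (cosh (2 * zeta) + -1 * sinh (2 * zeta))
        with (cosh (2 * zeta) - sinh (2 * zeta)) by ring.
      rewrite <- Hy; now apply is_derive_coord.
    - specialize (Hz t0); lra. }
  clear - Hinc HM Ha0 Hb0.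
  split; intros t0; destruct (Hinc t0) as (Hx & Hy & Hz).
  - split; trivial.
    apply point_eq; intros i.
    destruct (gamma (t0 + period a b)) as [[x1 y1] z1], (gamma t0) as [[x0 y0] z0].
    cbn in Hx, Hy, Hz.
    destruct i; cbn; unfold minus, plus, opp, scal, mult; cbn; unfold mult; cbn; lra.
  - unfold horizontal_distance; rewrite Hx, Hy.
    rewrite <- cosh_height by trivial.
    set (z := coord Oz (gamma t0)).
    assert (Hs : sign (a * b) ^ 2 = 1)
      by now apply sign_sq, Rmult_integral_contrapositive_currified.
    replace (-2 * z) with (- (2 * z)) by ring.
    transitivity (sqrt (displacement a b ^ 2
                        * (a ^ 2 * exp (2 * z) + b ^ 2 * exp (- (2 * z))))).
    + f_equal.
      transitivity (sign (a * b) ^ 2 * (displacement a b ^ 2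
                        * (a ^ 2 * exp (2 * z) + b ^ 2 * exp (- (2 * z)))));
        [ring | rewrite Hs; ring].
    + rewrite sqrt_mult_alt, sqrt_pow2 by (trivial || apply pow2_ge_0); reflexivity.
Qed.
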